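(* Let $H$ be an induced subgraph of a finite simple graph $G$, and let $s$ be an integer. If $\pi^{c}(H)\le n(H)-s$, then $\pi^{c}(G)\le n(G)-s$.
   Context: $n(\cdot)$ denotes the number of vertices. A configuration of cops on a graph is a function $C$ from its vertices to $\mathbb{Z}_{\ge 0}$ of size $\sum_v C(v)$. A pebbling step from a vertex $u$ with at least two cops to an adjacent vertex $v$ removes two cops from $u$ and adds one cop to $v$. In the cops and robbers pebbling game, cops are placed according to $C$, then a robber chooses a starting vertex; thereafter, in each turn the cops make pebbling steps, after which the robber either moves to an adjacent vertex or stays put. The robber is captured when he occupies a vertex holding at least one cop. The cop pebbling number $\pi^{c}(G)$ is the minimum $m$ such that some configuration of size $m$ allows the cops to capture the robber regardless of how he starts and moves. *)

(* Defs.v *)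
From Stdlib Require Import Relations.
From mathcomp Require Import all_boot all_order all_algebra.
From mathcomp Require Import boolp.

Set Implicit Arguments.
Unset Strict Implicit.
Unset Printing Implicit Defensive.

Record sgraph := SGraph {
  vertex :> finType;
  adj : rel vertex;
  adj_sym : symmetric adj;
  adj_irrefl : irreflexive adj }.

Section Induced.
Variables (G : sgraph) (S : {set G}).

Definition induced_adj : rel {x : G | x \in S} :=
  fun x y => adj (val x) (val y).

Lemma induced_adj_sym : symmetric induced_adj.
Proof. by move=> x y; exact: adj_sym. Qed.

Lemma induced_adj_irrefl : irreflexive induced_adj.
Proof. by move=> x; exact: adj_irrefl. Qed.

Definition induced : sgraph := SGraph induced_adj_sym induced_adj_irrefl.
End Induced.

(* How pebbling steps may be combined within a single turn of the cops.       *)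
(*   Sequential:   any finite sequence of steps, so a cop that has just moved *)
(*                 may take part in a further step of the same turn;          *)
(*   Simultaneous: all steps of the turn are made at once, so each cop takes  *)
(*                 part in at most one of them, as in the classical game.     *)
(* Under both rules the cops may pass.                                        *)
Inductive turn_rule := Sequential | Simultaneous.

Section Game.
Variables (rule : turn_rule) (G : sgraph).

Definition config := {ffun G -> nat}.

Definition config_size (C : config) : nat := \sum_v C v.

Definition pebbling_step (C C' : config) : Prop :=
  exists u v : G, [/\ adj u v, 2 <= C u &
    C' = [ffun w => C w - 2 * (w == u) + (w == v)]].

(* f (u, v) is the number of pebbling steps made from u to v. *)
Definition simultaneous_steps (C C' : config) : Prop :=
  exists f : {ffun G * G -> nat},
    [/\ forall u v, 0 < f (u, v) -> adj u v,
        forall u, 2 * (\sum_v f (u, v)) <= C u &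
        C' = [ffun w => C w - 2 * (\sum_v f (w, v)) + \sum_u f (u, w)]].

Definition cops_turn (C C' : config) : Prop :=
  match rule with
  | Sequential => clos_refl_trans config pebbling_step C C'
  | Simultaneous => simultaneous_steps C C'
  end.

(* cops_win C r: with the robber on r and the cops, placed as in C, to move,  *)
(* the cops can force a capture. On a finite graph only finitely many         *)
(* configurations are reachable, so being able to force a capture is the same *)
(* as being able to do so within a bounded number of turns.                   *)
Inductive cops_win : config -> G -> Prop :=
| WinNow (C : config) r : 0 < C r -> cops_win C r
| WinCatch (C C' : config) r : cops_turn C C' -> 0 < C' r -> cops_win C r
| WinChase (C C' : config) r : cops_turn C C' ->
    (forall r', (r' == r) || adj r r' -> cops_win C' r') -> cops_win C r.

Definition cops_suffice (m : nat) : Prop :=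
  exists C : config, config_size C = m /\ forall r, cops_win C r.

Lemma cops_suffice_exists : exists m, `[< cops_suffice m >].
Proof.
exists (config_size [ffun=> 1]); apply/asboolP.
by exists [ffun=> 1]; split=> // r; apply: WinNow; rewrite ffunE.
Qed.

Definition cop_pebbling_number : nat := ex_minn cops_suffice_exists.
End Game.

(* Main.v *)
(** Keep one stationary cop on every vertex outside [S] and play a winning
    strategy of the induced subgraph inside [S]: the robber is caught as soon
    as he stands outside [S], and otherwise he plays on the subgraph. *)
Require Import Defs.
From mathcomp Require Import all_boot all_order all_algebra.
From Stdlib Require Import Relations.
From mathcomp Require Import boolp zify.

Set Implicit Arguments.
Unset Strict Implicit.
Unset Printing Implicit Defensive.

Section Extension.
Variables (T : finType) (S : {set T}).
Local Notation sub := {x : T | x \in S}.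

(** The default [d] is kept general because two values are needed: [1] for configurations, the
    stationary cop on each vertex outside [S], and [0] for counts of pebbling steps, since no step
    touches those vertices. *)
Definition extend (d : nat) (F : sub -> nat) (x : T) : nat :=
  oapp F d (insub x).

Lemma extend_val d (F : sub -> nat) (x : sub) : extend d F (val x) = F x.
Proof. by rewrite /extend valK. Qed.

Lemma extend_out d (F : sub -> nat) x : x \notin S -> extend d F x = d.
Proof. by move=> xS; rewrite /extend insubN. Qed.

Lemma sum_extend d (F : sub -> nat) :
  \sum_x extend d F x = \sum_x F x + d * #|~: S|.
Proof.
rewrite (bigID [in S]) /=; congr addn; last first.
  rewrite (eq_bigr (fun=> d)); last by move=> x; exact: extend_out.
  rewrite sum_nat_const mulnC; congr (_ * _).
  by apply: eq_card => x; rewrite !inE.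
by rewrite big_sub; apply: eq_bigr => x _; exact: extend_val.
Qed.

End Extension.

Section Simulation.
Variables (rule : turn_rule) (G : sgraph) (S : {set G}).

Lemma induced_or_notin (x : G) : (exists y : induced S, x = val y) \/ x \notin S.
Proof.
case: (boolP (x \in S)) => xS; last by right.
by left; exists (exist _ x xS).
Qed.

Definition extend_config (C : config (induced S)) : config G :=
  [ffun x => extend 1 C x].

Lemma extend_config_val C (x : induced S) : extend_config C (val x) = C x.
Proof. by rewrite ffunE extend_val. Qed.

Lemma extend_config_out C x : x \notin S -> extend_config C x = 1.
Proof. by move=> xS; rewrite ffunE extend_out. Qed.

Lemma extend_pebbling_step C C' : pebbling_step C C' ->
  pebbling_step (extend_config C) (extend_config C').
Proof.
case=> u [v [uv Cu ->]]; exists (val u), (val v).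
split; [exact: uv | by rewrite extend_config_val |].
apply/ffunP => x; rewrite [RHS]ffunE.
have [[y ->]|xS] := induced_or_notin x.
  by rewrite !extend_config_val ffunE !(inj_eq val_inj).
rewrite !extend_config_out //.
(* A vertex outside [S] is neither end of the step, so its stationary cop stays. *)
have neq (y : induced S) : (x == val y) = false.
  by apply: contraNF xS => /eqP ->; exact: valP.
by rewrite !neq.
Qed.

Lemma extend_simultaneous_steps C C' : simultaneous_steps C C' ->
  simultaneous_steps (extend_config C) (extend_config C').
Proof.
case=> f [fadj fC ->].
(* The same steps seen in [G]: [f] extended by zero in each argument in turn. *)
pose g u v := extend 0 (fun u' => extend 0 (fun v' => f (u', v')) v) u.
have g_outl u v : u \notin S -> g u v = 0 by move=> uS; exact: extend_out.
have g_outr u v : v \notin S -> g u v = 0.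
  move=> vS; rewrite /g; have [[u' ->]|uS] := induced_or_notin u; last exact: extend_out.
  by rewrite extend_val extend_out.
have gE (u v : induced S) : g (val u) (val v) = f (u, v).
  by rewrite /g !extend_val.
have sum_gl (u : induced S) : \sum_v g (val u) v = \sum_v f (u, v).
  (* The added [0] is [0 * #|~: S|] by computation, so [sum_extend] applies backwards. *)
  rewrite -[RHS]addn0 -(sum_extend 0 (fun v => f (u, v))).
  by apply: eq_bigr => v _; rewrite /g extend_val.
have sum_gr (v : induced S) : \sum_u g u (val v) = \sum_u f (u, v).
  rewrite -[RHS]addn0 -(sum_extend 0 (fun u => f (u, v))).
  (* Here the fixed argument is the inner one, so the inner extension must be evaluated at [val v]
     under the binder. *)
  apply: eq_bigr => u _; congr (extend _ _ u).
  by apply/funext => u'; rewrite extend_val.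
exists [ffun p => g p.1 p.2].
have sumE u : \sum_v [ffun p => g p.1 p.2] (u, v) = \sum_v g u v.
  by apply: eq_bigr => v _; rewrite ffunE.
split=> [u v|u|].
- rewrite ffunE /=.
  have [[u' ->]|uS] := induced_or_notin u; last by rewrite g_outl.
  have [[v' ->]|vS] := induced_or_notin v; last by rewrite g_outr.
  by rewrite gE; exact: fadj.
- rewrite sumE; have [[u' ->]|uS] := induced_or_notin u; last first.
    by rewrite big1 // => v _; rewrite g_outl.
  by rewrite sum_gl extend_config_val.
apply/ffunP => x; rewrite [RHS]ffunE sumE.
under [X in _ = _ + X]eq_bigr do rewrite ffunE /=.
have [[y ->]|xS] := induced_or_notin x.
  by rewrite !extend_config_val ffunE sum_gl sum_gr.
rewrite !extend_config_out //.
have -> : \sum_v g x v = 0 by rewrite big1 // => v _; exact: g_outl.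
by rewrite big1 // => u _; exact: g_outr.
Qed.

Lemma extend_cops_turn C C' : cops_turn rule C C' ->
  cops_turn rule (extend_config C) (extend_config C').
Proof.
case: rule => /=; last exact: extend_simultaneous_steps.
elim=> [A B AB|A|A B D _ AB _ BD].
- exact/rt_step/extend_pebbling_step.
- exact: rt_refl.
- exact: rt_trans AB BD.
Qed.

Lemma extend_cops_win C (r : induced S) : cops_win rule C r ->
  cops_win rule (extend_config C) (val r).
Proof.
elim=> {C r} [C r Cr|C C' r CC' C'r|C C' r CC' _ IH].
- by apply: WinNow; rewrite extend_config_val.
- by apply: WinCatch (extend_cops_turn CC') _; rewrite extend_config_val.
apply: WinChase (extend_cops_turn CC') _ => r' rr'.
have [[y r'y]|r'S] := induced_or_notin r'.
  (* The reply is legal in [induced S] too: adjacency and equality there are both computed on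
     underlying vertices, so [rr'] fits [IH] by conversion. *)
  by rewrite r'y in rr' *; exact: IH.
by apply: WinNow; rewrite extend_config_out.
Qed.

Lemma cops_suffice_induced m : cops_suffice rule (induced S) m ->
  cops_suffice rule G (m + #|~: S|).
Proof.
case=> C [<- win]; exists (extend_config C); split=> [|r].
  rewrite /config_size; under eq_bigr do rewrite ffunE.
  by rewrite sum_extend mul1n.
have [[y ->]|rS] := induced_or_notin r; first exact: extend_cops_win.
by apply: WinNow; rewrite extend_config_out.
Qed.

Lemma cop_pebbling_number_induced :
  cop_pebbling_number rule G <= cop_pebbling_number rule (induced S) + #|~: S|.
Proof.
(* Minimality for [G] reduces the bound to sufficiency of that many cops, obtained from an optimal
   number on the subgraph. *)
rewrite {1}/cop_pebbling_number; case: ex_minnP => m _; apply.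
rewrite /cop_pebbling_number; case: ex_minnP => k /asboolP win _.
exact/asboolP/cops_suffice_induced.
Qed.

End Simulation.

Theorem theorem6 (rule : turn_rule) (G : sgraph) (S : {set G}) (s : int) :
  ((cop_pebbling_number rule (induced S))%:Z <= #|induced S|%:Z - s)%R ->
  ((cop_pebbling_number rule G)%:Z <= #|G|%:Z - s)%R.
Proof.
(* The stationary cops number exactly [#|G| - #|S|], so the saving [s] passes unchanged from the
   subgraph to [G]. *)
have := cop_pebbling_number_induced rule S.
have -> : #|induced S| = #|S| by rewrite card_sig.
have := cardsC S.
lia.
Qed.
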